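(* The fixed-point set of $T$ on $\mathcal E_3^{\mathrm{nd}}$ is $$\operatorname{Fix}(T)=\Bigl\{\bigl(-\tfrac12,-\tfrac12,-\tfrac12\bigr),\ (1,-1,-1),\ (-1,1,-1),\ (-1,-1,1),\ (-1,0,0),\ (0,-1,0),\ (0,0,-1)\Bigr\}.$$ In particular, the $3\times3$ correlation map has exactly seven fixed points on its natural nondegenerate domain.
   Context: For nonconstant $x,y\in\mathbb R^3$, with means $\bar x,\bar y$, the Pearson correlation is $\operatorname{corr}(x,y)=\frac{\sum_k(x_k-\bar x)(y_k-\bar y)}{\sqrt{\sum_k(x_k-\bar x)^2\sum_k(y_k-\bar y)^2}}$. For a real $3\times3$ matrix $A$ with nonconstant rows $r_1,r_2,r_3$, the correlation map is $[C(A)]_{ij}=\operatorname{corr}(r_i,r_j)$. For real $a,b,c$ let $A(a,b,c)=\begin{pmatrix} 1 & a & b \\ a & 1 & c \\ b & c & 1 \end{pmatrix}$. Let $\mathcal E_3=\{(a,b,c)\in[-1,1]^3:1+2abc-a^2-b^2-c^2\ge0\}$ (exactly the triples for which $A(a,b,c)$ is positive semidefinite), and let $\mathcal E_3^{\mathrm{nd}}$ be the set of $(a,b,c)\in\mathcal E_3$ such that all rows of $A(a,b,c)$ are nonconstant; one has $\mathcal E_3^{\mathrm{nd}}=\mathcal E_3\setminus\{(1,1,1)\}$. The map $T:\mathcal E_3^{\mathrm{nd}}\to\mathcal E_3^{\mathrm{nd}}$ is defined by $A(T(p))=C(A(p))$, and $\operatorname{Fix}(T)=\{p\in\mathcal E_3^{\mathrm{nd}}:T(p)=p\}$.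 *)

(* Defs.v *)
From HB Require Import structures.
From mathcomp Require Import all_boot all_order all_algebra.
From mathcomp Require Import boolp classical_sets functions cardinality reals.
From mathcomp Require Import ring lra.

Set Implicit Arguments.
Unset Strict Implicit.
Unset Printing Implicit Defensive.

Import Order.TTheory GRing.Theory Num.Theory.
Local Open Scope classical_set_scope.
Local Open Scope ring_scope.

Section Correlation.
Variable R : realType.
Implicit Types (x y : 'rV[R]_3) (M : 'M[R]_3) (p : R * R * R).

Definition mean x : R := (\sum_k x 0 k) / 3.

Definition nonconstant x : Prop := exists i j, x 0 i != x 0 j.

(* Meaningful for nonconstant x and y only: otherwise the denominator is 0
   and the quotient takes the default value 0. *)
Definition corr x y : R :=
  (\sum_k (x 0 k - mean x) * (y 0 k - mean y)) /
  Num.sqrt ((\sum_k (x 0 k - mean x) ^+ 2) * (\sum_k (y 0 k - mean y) ^+ 2)).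

Definition C M : 'M[R]_3 := \matrix_(i, j) corr (row i M) (row j M).

Definition A p : 'M[R]_3 :=
  let: (a, b, c) := p in
  \matrix_(i, j) nth 0 (nth [::] [:: [:: 1; a; b];
                                     [:: a; 1; c];
                                     [:: b; c; 1]] i) j.

Definition E3 : set (R * R * R) :=
  [set p | let: (a, b, c) := p in
    [/\ -1 <= a <= 1, -1 <= b <= 1, -1 <= c <= 1
      & 0 <= 1 + 2 * a * b * c - a ^+ 2 - b ^+ 2 - c ^+ 2]].

Definition E3nd : set (R * R * R) :=
  [set p | E3 p /\ forall i, nonconstant (row i (A p))].

(* The coordinates of the point T p determined by A (T p) = C (A p);
   see A_T and T_E3nd. *)
Definition T p : R * R * R :=
  (C (A p) 0 1, C (A p) 0 2, C (A p) 1 2).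

(* The normalized, centered vector: corr x y is the dot product of
   unit x and unit y. *)
Let unit x k : R :=
  (x 0 k - mean x) / Num.sqrt (\sum_k (x 0 k - mean x) ^+ 2).

Let sum_sqr_eq0 (f : 'I_3 -> R) : \sum_k f k ^+ 2 = 0 -> forall k, f k = 0.
Proof.
move=> s0 k; apply/eqP; rewrite -sqrf_eq0; apply/eqP.
by apply: (psumr_eq0P _ s0) => // i _; exact: sqr_ge0.
Qed.

Let var_gt0 x : nonconstant x -> 0 < \sum_k (x 0 k - mean x) ^+ 2.
Proof.
move=> [i [j nij]]; rewrite lt_neqAle sumr_ge0 ?andbT => [|k _]; last first.
  exact: sqr_ge0.
apply: contra nij; rewrite eq_sym => /eqP s0.
have H k : x 0 k = mean x by apply/eqP; rewrite -subr_eq0 (sum_sqr_eq0 s0).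
by rewrite !H.
Qed.

Let corr_unit x y : corr x y = \sum_k unit x k * unit y k.
Proof.
rewrite /corr sqrtrM ?sumr_ge0 // => [|k _]; last exact: sqr_ge0.
by rewrite invfM mulr_suml; apply: eq_bigr => k _; rewrite /unit mulrACA.
Qed.

Let unit_norm x : nonconstant x -> \sum_k unit x k ^+ 2 = 1.
Proof.
move=> /var_gt0 v0.
under eq_bigr do rewrite /unit expr_div_n sqr_sqrtr ?ltW//.
by rewrite -mulr_suml divff // gt_eqF.
Qed.

Let corrxx x : nonconstant x -> corr x x = 1.
Proof. by move=> /unit_norm <-; rewrite corr_unit. Qed.

Let corrC x y : corr x y = corr y x.
Proof. by rewrite !corr_unit; apply: eq_bigr => k _; rewrite mulrC. Qed.

Let corr_bound x y : nonconstant x -> nonconstant y -> -1 <= corr x y <= 1.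
Proof.
move=> /unit_norm nx /unit_norm ny; rewrite corr_unit.
have hp : 0 <= \sum_k (unit x k + unit y k) ^+ 2.
  by apply: sumr_ge0 => k _; exact: sqr_ge0.
have hm : 0 <= \sum_k (unit x k - unit y k) ^+ 2.
  by apply: sumr_ge0 => k _; exact: sqr_ge0.
move: nx ny hp hm; rewrite !big_ord_recl !big_ord0 => nx ny hp hm.
by apply/andP; split; nra.
Qed.

Let gram_ge0 x y z : nonconstant x -> nonconstant y -> nonconstant z ->
  0 <= 1 + 2 * corr x y * corr x z * corr y z
       - corr x y ^+ 2 - corr x z ^+ 2 - corr y z ^+ 2.
Proof.
move=> nx ny nz.
have -> : 1 + 2 * corr x y * corr x z * corr y z
       - corr x y ^+ 2 - corr x z ^+ 2 - corr y z ^+ 2 =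
  corr x x * corr y y * corr z z + 2 * corr x y * corr x z * corr y z
       - corr x y ^+ 2 * corr z z - corr x z ^+ 2 * corr y y
       - corr y z ^+ 2 * corr x x by rewrite !corrxx //; ring.
rewrite !corr_unit !big_ord_recl !big_ord0 /=.
set i := ord0; set j := lift _ _; set k := lift _ (lift _ _).
set e := (X in 0 <= X).
have -> : e =
  (unit x i * (unit y j * unit z k - unit y k * unit z j)
   - unit x j * (unit y i * unit z k - unit y k * unit z i)
   + unit x k * (unit y i * unit z j - unit y j * unit z i)) ^+ 2.
  by rewrite /e; ring.
exact: sqr_ge0.
Qed.

Let corr1P x y : nonconstant x -> nonconstant y -> corr x y = 1 ->
  exists2 st : R * R, 0 < st.1 /\ 0 < st.2 &
    forall i j, (x 0 i - x 0 j) / st.1 = (y 0 i - y 0 j) / st.2.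
Proof.
move=> nx ny c1.
have uE k : unit x k = unit y k.
  have s0 : \sum_k (unit x k - unit y k) ^+ 2 = 0.
    move: c1 (unit_norm nx) (unit_norm ny).
    rewrite corr_unit !big_ord_recl !big_ord0 => h1 h2 h3.
    by nra.
  by apply/eqP; rewrite -subr_eq0 (sum_sqr_eq0 s0).
exists (Num.sqrt (\sum_k (x 0 k - mean x) ^+ 2),
        Num.sqrt (\sum_k (y 0 k - mean y) ^+ 2)).
  by rewrite !sqrtr_gt0; split; exact: var_gt0.
move=> i j /=.
by have := congr2 (fun u v => u - v) (uE i) (uE j);
  rewrite /unit -!mulrBl !opprB !addrA !subrK.
Qed.

Let ord3E (i : 'I_3) : [\/ i = 0, i = 1 | i = 2].
Proof.
by case: i => [[|[|[|//]]] ?]; [constructor 1|constructor 2|constructor 3];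
  exact/val_inj.
Qed.

Lemma A_T p : E3nd p -> A (T p) = C (A p).
Proof.
move=> [_ nd]; apply/matrixP => i j; rewrite /T /A mxE -/(A p) !mxE.
by have [->|->|->] := ord3E i; have [->|->|->] := ord3E j => //=;
  rewrite ?corrxx // corrC.
Qed.


Lemma E3ndE : E3nd = E3 `\ (1, 1, 1).
Proof.
apply/seteqP; split=> [p [Ep nd]|[[a b] c] [Ep p1]]; split=> //.
- move=> p1; have [i [j]] := nd 0; rewrite p1 !mxE.
  by have [->|->|->] := ord3E i; have [->|->|->] := ord3E j; rewrite eqxx.
- move: (Ep) => -[a1 b1 c1 d0] i; apply: contrapT => cst.
  have rowE j k : A (a, b, c) i j = A (a, b, c) i k.
    apply/eqP; apply: contrapT => /negP njk.
    by apply: cst; exists j, k; rewrite !mxE; rewrite !mxE in njk.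
  have := rowE 0 1; have := rowE 0 2; have := rowE 1 2; rewrite !mxE.
  move=> e1 e2 e3; apply: p1 => /=.
  have [i0|i0|i0] := ord3E i; rewrite i0 /= in e1 e2 e3; subst.
  + suff -> : c = 1 by [].
    apply/eqP; rewrite -subr_eq0 -sqrf_eq0; apply/eqP; nra.
  + suff -> : b = 1 by [].
    apply/eqP; rewrite -subr_eq0 -sqrf_eq0; apply/eqP; nra.
  + suff -> : a = 1 by [].
    apply/eqP; rewrite -subr_eq0 -sqrf_eq0; apply/eqP; nra.
Qed.

Lemma T_E3nd : {homo T : p / E3nd p}.
Proof.
move=> p ndp; rewrite E3ndE; have [_ nd] := ndp; split.
  rewrite /T /E3 /= !mxE; split; [exact: corr_bound..|exact: gram_ge0].
rewrite /T /= !mxE => -[/(corr1P (nd 0) (nd 1)) [st [s0 t0] h1]].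
move=> /(corr1P (nd 0) (nd 2)) [st' [s0' t0'] h2].
move=> /(corr1P (nd 1) (nd 2)) [st'' [s0'' t0''] h3].
have aux (s t d : R) : 0 < s -> 0 < t -> d / s = - d / t -> d = 0.
  move=> s_gt0 t_gt0 /eqP; rewrite mulNr -subr_eq0 opprK -mulrDr mulf_eq0.
  by rewrite (gt_eqF (addr_gt0 _ _)) ?invr_gt0 // orbF => /eqP.
move: h1 h2 h3 ndp; case: p nd => [[a b] c] nd h1 h2 h3; rewrite E3ndE.
have := h1 0 1; have := h2 0 2; have := h3 1 2; rewrite !mxE /=.
rewrite -(opprB 1 a) -(opprB 1 b) -(opprB 1 c).
move=> /(aux _ _ _ s0'' t0'')/eqP; rewrite subr_eq0 => /eqP <-.
move=> /(aux _ _ _ s0' t0')/eqP; rewrite subr_eq0 => /eqP <-.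
move=> /(aux _ _ _ s0 t0)/eqP; rewrite subr_eq0 => /eqP <-.
by case.
Qed.

End Correlation.

HB.instance Definition _ (R : realType) :=
  isFun.Build _ _ (@E3nd R) (@E3nd R) (@T R) (@T_E3nd R).

Definition Fix (U : Type) (D : set U) (f : {fun D >-> D}) : set U :=
  [set p | D p /\ f p = p].

(* Main.v *)
Require Import Defs.
From mathcomp Require Import all_boot all_order all_algebra.
From mathcomp Require Import boolp classical_sets functions cardinality reals.
From mathcomp Require Import finmap ring lra.

Import Order.TTheory GRing.Theory Num.Theory.

(** Write [B = A H A], where [H = 1 - J / 3] is the centering projection ([J]
    being the all-ones matrix); the entries of [B] are the scatters
    (unnormalized covariances) of the rows of the symmetric matrix [A].  A
    point is fixed by the correlation map exactly when [B = D A D] for some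
    positive diagonal matrix [D], whose entries are the norms of the centered
    rows ([fixedP]).

    Since [H] is singular, so is [B], and [D] being invertible, [det A = 0]
    ([scaled_det0]).  Moreover [A v = 0] gives [D A D v = A H A v = 0], hence
    [A (D v) = 0]: the kernel of [A] is stable under [D].

    If no off-diagonal entry of [A] is 1 or -1, this kernel is a line spanned
    by a vector without zero coordinate, which forces [D] to be scalar
    ([scaled_eq_weights12]).  Then the three diagonal entries of [B] coincide,
    which makes the three parameters equal, and [det A = 0] leaves only the
    value -1/2 ([scaled_interior]).

    If some off-diagonal entry is 1 or -1, then up to a permutation of the
    coordinates it is the last one, and [det A = 0] makes the last two rows
    equal or opposite.  A single parameter remains, and its equation is solved
    by hand ([scaled_edge]).

    The condition [B = D A D] is invariant under simultaneous permutations of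
    rows and columns, so three of the seven points represent all of them when
    one checks that they are indeed fixed. *)

Set Implicit Arguments.
Unset Strict Implicit.
Unset Printing Implicit Defensive.


Local Open Scope classical_set_scope.
Local Open Scope ring_scope.

(** * Rescaled scatter matrices *)

Section ScaledGram.
Variable R : realFieldType.
Implicit Types (a b c d e f : R).

Definition scatter (x1 x2 x3 y1 y2 y3 : R) : R :=
  x1 * y1 + x2 * y2 + x3 * y3 - (x1 + x2 + x3) * (y1 + y2 + y3) / 3.

Definition det_corr a b c : R := 1 + 2 * a * b * c - a ^+ 2 - b ^+ 2 - c ^+ 2.

(** The equation [A H A = D A D], entry by entry, for [D] the diagonal matrix
    with entries [d], [e], [f].  This form is free of square roots and
    quotients, and the right-hand sides are grouped so that the weights appear
    as in the products of norms of the denominators of correlations. *)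
Record scaled a b c d e f : Prop := Scaled {
  scaled1_gt0 : 0 < d;
  scaled2_gt0 : 0 < e;
  scaled3_gt0 : 0 < f;
  scaled11 : scatter 1 a b 1 a b = d * d;
  scaled22 : scatter a 1 c a 1 c = e * e;
  scaled33 : scatter b c 1 b c 1 = f * f;
  scaled12 : scatter 1 a b a 1 c = a * (d * e);
  scaled13 : scatter 1 a b b c 1 = b * (d * f);
  scaled23 : scatter a 1 c b c 1 = c * (e * f)
}.

(** The transpositions (1 2) and (2 3) of the rows and columns of [A] act on
    the off-diagonal entries by exchanging [b] with [c] and [a] with [b]. *)
Lemma scaled_swap12 a b c d e f : scaled a b c d e f -> scaled a c b e d f.
Proof.
case=> d0 e0 f0; rewrite /scatter => h11 h22 h33 h12 h13 h23.
by split; rewrite // /scatter; lra.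
Qed.

Lemma scaled_swap23 a b c d e f : scaled a b c d e f -> scaled b a c d f e.
Proof.
case=> d0 e0 f0; rewrite /scatter => h11 h22 h33 h12 h13 h23.
by split; rewrite // /scatter; lra.
Qed.

(** Compare determinants in [A H A = D A D]: the left one vanishes because
    [H] kills the constant vectors. *)
Lemma scaled_det0 a b c d e f : scaled a b c d e f -> det_corr a b c = 0.
Proof.
case=> d0 e0 f0 h11 h22 h33 h12 h13 h23.
have detB : scatter 1 a b 1 a b * scatter a 1 c a 1 c * scatter b c 1 b c 1
    + 2 * scatter 1 a b a 1 c * scatter 1 a b b c 1 * scatter a 1 c b c 1
    - scatter 1 a b 1 a b * scatter a 1 c b c 1 ^+ 2
    - scatter a 1 c a 1 c * scatter 1 a b b c 1 ^+ 2
    - scatter b c 1 b c 1 * scatter 1 a b a 1 c ^+ 2 = 0.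
  by rewrite /scatter; field.
rewrite h11 h22 h33 h12 h13 h23 in detB.
have def0 : d * e * f != 0 by rewrite !mulf_neq0 ?gt_eqF.
apply: (mulfI (expf_neq0 2 def0)); rewrite mulr0 -detB /det_corr; ring.
Qed.

(** [v = (v1, v2, v3)], the first column of the adjugate of [A], spans the
    kernel of [A].  As [D v] lies in that kernel too, so does [D v - d v],
    whose first coordinate is 0.  The lower right block of [A], of determinant
    [1 - c ^+ 2], then shows [(e - d) * v2 = 0]. *)
Lemma scaled_eq_weights12 a b c d e f : scaled a b c d e f ->
  b ^+ 2 != 1 -> c ^+ 2 != 1 -> d = e.
Proof.
move=> S b1 c1; have det0 := scaled_det0 S.
case: S => d0 e0 f0 h11 h22 h33 h12 h13 h23.
set v1 := 1 - c ^+ 2; set v2 := b * c - a; set v3 := a * c - b.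
(* The last two rows of [A D v = 0]: multiplied by the weight of the row,
   they read [A H A v = 0], where [A v] is [det A] times the first basis
   vector. *)
have row2 : a * d * v1 + e * v2 + c * f * v3 = 0.
  apply: (mulfI (lt0r_neq0 e0)); rewrite mulr0.
  transitivity (det_corr a b c * (a - (a + 1 + c) / 3)); last by rewrite det0 mul0r.
  transitivity (a * (d * e) * v1 + e * e * v2 + c * (e * f) * v3); first ring.
  by rewrite -h12 -h22 -h23 /scatter /det_corr /v1 /v2 /v3; field.
have row3 : b * d * v1 + c * e * v2 + f * v3 = 0.
  apply: (mulfI (lt0r_neq0 f0)); rewrite mulr0.
  transitivity (det_corr a b c * (b - (b + c + 1) / 3)); last by rewrite det0 mul0r.
  transitivity (b * (d * f) * v1 + c * (e * f) * v2 + f * f * v3); first ring.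
  by rewrite -h13 -h33 -h23 /scatter /det_corr /v1 /v2 /v3; field.
have v1_neq0 : v1 != 0 by rewrite subr_eq0 eq_sym.
(* A minor of the adjugate, which has rank at most 1 as [det A = 0]. *)
have v2_neq0 : v2 != 0.
  rewrite -sqrf_eq0.
  have -> : v2 ^+ 2 = (1 - b ^+ 2) * v1 - det_corr a b c.
    by rewrite /v1 /v2 /det_corr; ring.
  by rewrite det0 subr0 mulf_neq0 // subr_eq0 eq_sym.
apply/esym/subr0_eq/(mulfI (mulf_neq0 v1_neq0 v2_neq0)); rewrite mulr0.
transitivity ((a * d * v1 + e * v2 + c * f * v3)
              - c * (b * d * v1 + c * e * v2 + f * v3)).
  by rewrite /v1 /v2 /v3; ring.
by rewrite row2 row3 mulr0 subr0.
Qed.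

(** The weights being equal, so are the diagonal entries of [A H A].  Their
    differences factor into linear forms, for instance
    [(b - c) * (b + c - 1 - a)], which forces [a = b = c]. *)
Lemma scaled_interior a b c d e f : scaled a b c d e f ->
  a ^+ 2 != 1 -> b ^+ 2 != 1 -> c ^+ 2 != 1 ->
  (a, b, c) = (- (1 / 2), - (1 / 2), - (1 / 2)).
Proof.
move=> S a1 b1 c1; have det0 := scaled_det0 S.
have de := scaled_eq_weights12 S b1 c1.
have df := scaled_eq_weights12 (scaled_swap23 S) a1 c1.
case: S; rewrite -de -df /scatter => _ _ _ h11 h22 h33 _ _ _.
have neq1 (x : R) : x ^+ 2 != 1 -> (x == 1) = false.
  by move=> x1; apply: contraNF x1 => /eqP ->; rewrite expr1n.
have bc : b = c.
  have /eqP : (b - c) * (b + c - 1 - a) = 0 by lra.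
  rewrite mulf_eq0 => /orP[/eqP/subr0_eq//|/eqP a_def].
  (* With [a = b + c - 1], equality of the first and last diagonal entries,
     [(a - c) * (a + c - 1 - b) = 0], becomes twice this product. *)
  have /eqP : (b - 1) * (c - 1) = 0 by nra.
  by rewrite mulf_eq0 !subr_eq0 (neq1 _ b1) (neq1 _ c1).
have ac : a = c.
  have /eqP : (a - 1) * (a - c) = 0 by rewrite bc in h11 h22 h33; lra.
  by rewrite mulf_eq0 !subr_eq0 (neq1 _ a1) /= => /eqP.
have /eqP : (1 - c) ^+ 2 * (1 + 2 * c) = 0.
  by rewrite -det0 /det_corr ac bc; ring.
rewrite mulf_eq0 sqrf_eq0 subr_eq0 eq_sym (neq1 _ c1) /= => /eqP c_def.
by rewrite ac bc; congr (_, _, _); lra.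
Qed.

(** For [c = 1] the determinant is [- (a - b) ^+ 2], so the last two rows of
    [A] coincide and their correlation with the first one is -1.  For
    [c = -1] it is [- (a + b) ^+ 2], so these rows are opposite; the first two
    rows have scatter [8 / 3 * a], and comparing it with the product of their
    norms leaves [a = 0] or [a ^+ 2 = 1]. *)
Lemma scaled_edge a b c d e f : scaled a b c d e f -> c ^+ 2 = 1 ->
  [\/ (a, b, c) = (1, -1, -1), (a, b, c) = (-1, 1, -1),
      (a, b, c) = (-1, -1, 1) | (a, b, c) = (0, 0, -1)].
Proof.
move=> S /eqP; rewrite sqrf_eq1 => c1; have := scaled_det0 S.
rewrite /det_corr; case: S => d0 e0 f0 + + _ + _ _; rewrite /scatter.
case/orP: c1 => /eqP -> h11 h22 h12 det0.
  have /eqP : (a - b) ^+ 2 = 0 by lra.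
  rewrite sqrf_eq0 subr_eq0 => /eqP ab; rewrite -ab in h11 h12 *.
  have de : d = e.
    by apply/eqP; rewrite -(eqrXn2 (n := 2)) ?ltW //; apply/eqP; lra.
  rewrite -de in h12.
  have /eqP : (a + 1) * (d * d) = 0 by lra.
  rewrite !mulf_eq0 !(gt_eqF d0) !orbF addr_eq0 => /eqP ->.
  by constructor 3.
have /eqP : (a + b) ^+ 2 = 0 by lra.
rewrite sqrf_eq0 addrC addr_eq0 => /eqP b_def; rewrite b_def in h11 h12 *.
have /eqP : a * (d * e - 8 / 3) = 0 by lra.
rewrite mulf_eq0 subr_eq0 => /orP[/eqP ->|/eqP de].
  by constructor 4; rewrite oppr0.
(* Squaring [d * e = 8 / 3] and substituting the two diagonal equations gives
   a biquadratic equation in [a]. *)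
have : (d * d) * (e * e) = (8 / 3) ^+ 2 by rewrite -de; ring.
rewrite -h11 -h22 => a4.
have /eqP : (a ^+ 2 - 1) * (3 * a ^+ 2 + 13) = 0 by lra.
have pos : 0 < 3 * a ^+ 2 + 13 by have := sqr_ge0 a; lra.
rewrite mulf_eq0 (gt_eqF pos) orbF subr_eq0 sqrf_eq1 => /orP[] /eqP ->.
  by constructor 1.
by constructor 2; rewrite opprK.
Qed.

End ScaledGram.

(** * The seven solutions *)

Definition fixed_list (R : fieldType) : seq (R * R * R) :=
  [:: (- (1 / 2), - (1 / 2), - (1 / 2));
      (1, -1, -1); (-1, 1, -1); (-1, -1, 1);
      (-1, 0, 0); (0, -1, 0); (0, 0, -1)].

Lemma scaled_in_fixed_list (R : realFieldType) (a b c d e f : R) :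
  scaled a b c d e f -> (a, b, c) \in fixed_list R.
Proof.
move=> S; rewrite /fixed_list !inE.
have [c1|c1] := eqVneq (c ^+ 2) 1.
  by have [->|->|->|->] := scaled_edge S c1; rewrite eqxx ?orbT.
have [b1|b1] := eqVneq (b ^+ 2) 1.
  have S' := scaled_swap12 S.
  by case: (scaled_edge S' b1) => -[-> -> ->]; rewrite eqxx ?orbT.
have [a1|a1] := eqVneq (a ^+ 2) 1.
  have S' := scaled_swap12 (scaled_swap23 S).
  by case: (scaled_edge S' a1) => -[-> -> ->]; rewrite eqxx ?orbT.
by rewrite (scaled_interior S) ?eqxx.
Qed.

(** The weights are the norms of the centered rows, read off from the diagonal
    of [A H A]; they are irrational, whence the real closed field. *)
Lemma fixed_list_scaled (R : rcfType) (a b c : R) :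
  (a, b, c) \in fixed_list R -> exists d e f, scaled a b c d e f.
Proof.
have sq (x : R) : 0 < x -> Num.sqrt x * Num.sqrt x = x.
  by move=> x0; rewrite -expr2 sqr_sqrtr // ltW.
have pos (x : R) : 0 < x -> 0 < Num.sqrt x by rewrite sqrtr_gt0.
have h32 : 0 < 3 / 2 :> R by lra.
have h83 : 0 < 8 / 3 :> R by lra.
have h23 : 0 < 2 / 3 :> R by lra.
have h2 : 0 < 2 :> R by lra.
have S1 : scaled (1 : R) (-1) (-1) (Num.sqrt (8 / 3)) (Num.sqrt (8 / 3))
                   (Num.sqrt (8 / 3)).
  by split; rewrite ?pos // /scatter ?sq //; lra.
have S2 : scaled (0 : R) 0 (-1) (Num.sqrt (2 / 3)) (Num.sqrt 2) (Num.sqrt 2).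
  by split; rewrite ?pos // /scatter ?sq //; lra.
rewrite /fixed_list !inE => /or4P[|||/or4P[]] /eqP[-> -> ->].
- exists (Num.sqrt (3 / 2)), (Num.sqrt (3 / 2)), (Num.sqrt (3 / 2)).
  by split; rewrite ?pos // /scatter ?sq //; lra.
- by do 3!eexists; exact: S1.
- by do 3!eexists; exact: scaled_swap23 S1.
- by do 3!eexists; exact: scaled_swap12 (scaled_swap23 S1).
- do 3!eexists; apply: scaled_swap23; apply: scaled_swap12; exact: S2.
- by do 3!eexists; exact: scaled_swap12 S2.
- by do 3!eexists; exact: S2.
Qed.

(** * From correlations to rescaled scatter matrices *)

Section FixedPoints.
Variable R : realType.
Implicit Types (x y : 'rV[R]_3).

Let row_scatter x y : R :=
  scatter (x 0 0) (x 0 1) (x 0 2) (y 0 0) (y 0 1) (y 0 2).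

Lemma ord3E (i : 'I_3) : [\/ i = 0, i = 1 | i = 2].
Proof.
by case: i => [[|[|[|//]]] ?]; [constructor 1|constructor 2|constructor 3];
  exact/val_inj.
Qed.

Lemma corr_scatter x y :
  corr x y = row_scatter x y / Num.sqrt (row_scatter x x * row_scatter y y).
Proof.
have dev (u v : 'rV[R]_3) :
    \sum_k (u 0 k - mean u) * (v 0 k - mean v) = row_scatter u v.
  rewrite /mean /row_scatter /scatter !big_ord_recl !big_ord0.
  have -> : lift ord0 ord0 = 1 :> 'I_3 by exact/val_inj.
  have -> : lift ord0 (lift ord0 ord0) = 2 :> 'I_3 by exact/val_inj.
  have -> : ord0 = 0 :> 'I_3 by exact/val_inj.
  by field.
rewrite /corr dev; congr (_ / Num.sqrt (_ * _)); rewrite -dev;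
  by apply: eq_bigr => k _; rewrite expr2.
Qed.

(** Three times the scatter of [x] with itself is the sum of the squared
    differences of the coordinates of [x]. *)
Lemma row_scatter_gt0 x : nonconstant x -> 0 < row_scatter x x.
Proof.
case=> i [j]; apply: contraNT; rewrite -leNgt /row_scatter /scatter => le0.
have s01 := sqr_ge0 (x 0 0 - x 0 1).
have s02 := sqr_ge0 (x 0 0 - x 0 2).
have s12 := sqr_ge0 (x 0 1 - x 0 2).
have /eqP : (x 0 0 - x 0 1) ^+ 2 = 0 by lra.
have /eqP : (x 0 0 - x 0 2) ^+ 2 = 0 by lra.
rewrite !sqrf_eq0 !subr_eq0 => /eqP x02 /eqP x01.
by have [->|->|->] := ord3E i; have [->|->|->] := ord3E j;
  rewrite -?x01 -?x02.
Qed.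

(** For a fixed point the weights are the norms of the centered rows; for the
    converse, the diagonal equations say that positive weights are these
    norms. *)
Lemma fixedP (a b c : R) : E3nd (a, b, c) ->
  T (a, b, c) = (a, b, c) <-> exists d e f, scaled a b c d e f.
Proof.
move=> [_ nd]; split.
  move=> [].
  rewrite !mxE !corr_scatter.
  have := row_scatter_gt0 (nd 0); have := row_scatter_gt0 (nd 1).
  have := row_scatter_gt0 (nd 2).
  rewrite /row_scatter !mxE /=.
  set B11 := scatter 1 a b 1 a b; set B22 := scatter a 1 c a 1 c.
  set B33 := scatter b c 1 b c 1 => B33_gt0 B22_gt0 B11_gt0 h12 h13 h23.
  exists (Num.sqrt B11), (Num.sqrt B22), (Num.sqrt B33).
  have num (u v w z : R) : 0 < u -> 0 < v -> w / Num.sqrt (u * v) = z ->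
      w = z * (Num.sqrt u * Num.sqrt v).
    move=> u0 v0 <-; rewrite sqrtrM ?ltW // divfK //.
    by rewrite mulf_neq0 // gt_eqF // sqrtr_gt0.
  split; rewrite ?sqrtr_gt0 //; try by rewrite -expr2 sqr_sqrtr // ltW.
  - exact: num h12.
  - exact: num h13.
  - exact: num h23.
move=> [d [e [f [d0 e0 f0 h11 h22 h33 h12 h13 h23]]]].
have quot (u v z : R) : 0 < u -> 0 < v ->
    z * (u * v) / Num.sqrt (u * u * (v * v)) = z.
  move=> u0 v0; rewrite mulrACA -expr2 sqrtr_sqr gtr0_norm ?mulr_gt0 //.
  by rewrite mulfK // mulf_neq0 // gt_eqF.
rewrite /T !mxE !corr_scatter /row_scatter !mxE /=.
by rewrite h11 h22 h33 h12 h13 h23 !quot.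
Qed.

Lemma fixed_list_E3nd (p : R * R * R) : p \in fixed_list R -> E3nd p.
Proof.
rewrite E3ndE; case: p => [[a b] c] p7; split.
  rewrite /E3 /=; move: p7; rewrite /fixed_list !inE.
  by move=> /or4P[|||/or4P[]] /eqP[-> -> ->]; split; lra.
by move=> -[a1 b1 c1]; move: p7; rewrite /fixed_list !inE a1 b1 c1;
  move=> /or4P[|||/or4P[]] /eqP[]; lra.
Qed.

Lemma fixed_list_uniq : uniq (fixed_list R).
Proof.
have n1 : (1 == -1 :> R) = false by apply/eqP; lra.
have n2 : (0 == -1 :> R) = false by apply/eqP; lra.
have n3 : (-(1/2) == -1 :> R) = false by apply/eqP; lra.
have n4 : (-(1/2) == 1 :> R) = false by apply/eqP; lra.
have n5 : (-(1/2) == 0 :> R) = false by apply/eqP; lra.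
have n6 : (1 == 0 :> R) = false by apply/eqP; lra.
rewrite /fixed_list /= !inE !xpair_eqE ?(eq_sym (-1)).
by rewrite !(n1, n2, n3, n4, n5, n6) ?andbF.
Qed.

End FixedPoints.

Unset Implicit Arguments.

Theorem theorem3 (R : realType) :
  Fix (@T R : {fun @E3nd R >-> @E3nd R}) =
    [set (- (1 / 2), - (1 / 2), - (1 / 2));
         (1, -1, -1); (-1, 1, -1); (-1, -1, 1);
         (-1, 0, 0); (0, -1, 0); (0, 0, -1)]
  /\ (Fix (@T R : {fun @E3nd R >-> @E3nd R}) #= `I_7)%card.
Proof.
have FixE : Fix (@T R : {fun @E3nd R >-> @E3nd R}) = [set` fixed_list R].
  apply/seteqP; split=> [[[a b] c] [nd /(fixedP nd)]|[[a b] c] p7].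
    by move=> [d [e [f /scaled_in_fixed_list]]].
  have nd := fixed_list_E3nd p7; split=> //.
  exact/(fixedP nd)/fixed_list_scaled.
split.
  rewrite FixE; apply/seteqP; split=> p; rewrite /= /fixed_list !inE.
    move=> /or4P[|||/or4P[]] /eqP ->; tauto.
  by move=> [[[[[[->|->]|->]|->]|->]|->]|->]; rewrite eqxx ?orbT.
have -> : Fix (@T R : {fun @E3nd R >-> @E3nd R})
  = [set` seq_fset tt (fixed_list R)].
  by rewrite FixE; apply/seteqP; split=> p; rewrite /mkset seq_fsetE.
by apply/card_eq_fsetP; rewrite size_seq_fset undup_id // fixed_list_uniq.
Qed.
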